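(* Let $\mu$ be a Borel probability measure on the kale $\mathcal K$ that is integrable, i.e. $\int_{\mathcal K} d(\mathbf 0,p)\,d\mu(p)<\infty$, and nondegenerate. Then $\mu$ is either fully sticky, partly sticky, or nonsticky. Furthermore, if $\mu$ is partly sticky, then the set of angles $\theta\in\mathbb R/\alpha\mathbb Z$ with $m_{\theta,1}\ge 0$ is a closed interval $[A,B]$ of length $|A-B|<\pi$ (possibly $A=B$); if $\mu$ is nonsticky, then the set of angles with $m_{\theta,1}\ge 0$ is a closed interval $[A,B]$ of length $|A-B|\le\pi$, and the function $\theta\mapsto m_{\theta,1}$ is strictly concave on its interior $(A,B)$.
   Context: Fix $\alpha>2\pi$. The kale is $\mathcal K=\big((0,\infty)\times(\mathbb R/\alpha\mathbb Z)\big)\cup\{\mathbf 0\}$; points are written $(r,\theta)$ with $r\ge 0$, $\theta\in\mathbb R/\alpha\mathbb Z$, and $(0,\theta)=\mathbf 0$ for every $\theta$. For angles put $|\theta'-\theta|=\min_{n\in\mathbb Z}|n\alpha+\theta'-\theta|$; when $|\theta'-\theta|\le\pi$, the symbol $\theta'-\theta$ denotes the unique representative in $[-\pi,\pi]$. The metric is $d((r_1,\theta_1),(r_2,\theta_2))^2=(r_1+r_2)^2$ if $|\theta_1-\theta_2|\ge\pi$ and $=r_1^2+r_2^2-2r_1r_2\cos|\theta_1-\theta_2|$ if $|\theta_1-\theta_2|\le\pi$; in particular $d(\mathbf 0,(r,\theta))=r$. Folding map: $F_\theta:\mathcal K\to\mathbb R^2$ sends $\mathbf 0$ to $0$ and,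 in polar coordinates on $\mathbb R^2$, $F_\theta(r',\theta')=(r',\theta'-\theta)$ if $r'>0$, $|\theta'-\theta|\le\pi$, and $F_\theta(r',\theta')=(r',\pi)$ if $r'>0$, $|\theta'-\theta|\ge\pi$. With $e_1,e_2$ the standard basis of $\mathbb R^2$, the folded first moment is $m_\theta=\int_{\mathcal K}F_\theta(p)\,d\mu(p)=(m_{\theta,1},m_{\theta,2})\in\mathbb R^2$ (cartesian coordinates), so $m_{\theta,i}=\int_{\mathcal K}e_i\cdot F_\theta(p)\,d\mu(p)$. Let $K=\{\theta\in\mathbb R/\alpha\mathbb Z: m_{\theta,1}\ge 0\}$. The measure $\mu$ is fully sticky if $K=\emptyset$; partly sticky if $K\neq\emptyset$ and $m_{\theta,1}=0$ for all $\theta\in K$; nonsticky if $K$ has non-empty interior and $m_{\theta,1}>0$ on $\mathrm{int}(K)$. Nondegenerate means: $\mu(R_{\theta,\theta'})<1$ for all angles $\theta,\theta'$ with $|\theta-\theta'|\ge\pi$, where $R_{\theta,\theta'}=\{(r,\theta):r\ge 0\}\cup\{(r,\theta'):r\ge 0\}$. *)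

(* Defs.v *)
From HB Require Import structures.
From mathcomp Require Import all_boot all_order all_algebra.
From mathcomp Require Import all_classical all_reals all_analysis.

Set Implicit Arguments.
Unset Strict Implicit.
Unset Printing Implicit Defensive.

Import Order.TTheory GRing.Theory Num.Theory.
Import numFieldNormedType.Exports.

Local Open Scope classical_set_scope.
Local Open Scope ring_scope.
Local Open Scope quotient_scope.

Section circle.
Context {R : realType}.
Implicit Type alpha : R.

Definition multiples alpha : {pred R} :=
  fun x => `[< exists n : int, x = n%:~R * alpha >].

Lemma multiples_zmod_closed alpha : zmod_closed (multiples alpha).
Proof.
split=> [|_ _ /asboolP[m ->] /asboolP[n ->]]; apply/asboolP.
  by exists 0; rewrite mul0r.
by exists (m - n); rewrite intrB mulrBl.
Qed.

HB.instance Definition _ alpha :=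
  GRing.isZmodClosed.Build R (multiples alpha) (multiples_zmod_closed alpha).

(* R / alpha Z as an additive group, with the quotient topology. *)
Definition circle alpha : Type :=
  quotient_topology (Quotient.quot (multiples alpha)).

HB.instance Definition _ alpha := Topological.on (circle alpha).
HB.instance Definition _ alpha := Pointed.on (circle alpha).
(* A copy of the instance of the group quotient would bring in a second choice
   structure. *)
HB.instance Definition _ alpha :=
  let Q : zmodType := Quotient.quot (multiples alpha) in
  GRing.isZmodule.Build (circle alpha)
    (@addrA Q) (@addrC Q) (@add0r Q) (@addNr Q).

Definition to_circle alpha (x : R) : circle alpha :=
  \pi_(Quotient.quot (multiples alpha)) x.

(* The lifts of t2 - t1 to R are the numbers n alpha + x2 - x1, where n is an
   integer and x1, x2 are any lifts of t1, t2; for alpha != 0 the infimum is a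
   minimum. *)
Definition angle_dist alpha (t1 t2 : circle alpha) : R :=
  inf [set `|x| | x in [set x : R | to_circle alpha x = t2 - t1]].

(* The representative of t2 - t1 in [-pi, pi], unique if 2 pi < alpha; the
   value is meaningless if angle_dist t1 t2 > pi. *)
Definition angle_diff alpha (t1 t2 : circle alpha) : R :=
  xget 0 [set x : R | - pi <= x <= pi /\ to_circle alpha x = t2 - t1].

Definition circle_arc alpha (a b : R) : set (circle alpha) :=
  [set to_circle alpha x | x in `[a, b]].

End circle.

Arguments circle_arc {R} alpha a b.

Section kale.
Context {R : realType}.
Implicit Type alpha : R.

(* None is the apex 0. *)
Definition kale alpha : Type := option ({r : R | 0 < r} * circle alpha).

HB.instance Definition _ alpha := Pointed.on (kale alpha).

Definition apex alpha : kale alpha := None.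

(* The point (r, t) for r >= 0; in particular kale_polar 0 t = apex alpha. *)
Definition kale_polar alpha (r : R) (t : circle alpha) : kale alpha :=
  omap (fun s => (s, t)) (insub r).

Definition kale_radius alpha (p : kale alpha) : R :=
  if p is Some (r, _) then val r else 0.

Definition kale_dist alpha (p q : kale alpha) : R :=
  match p, q with
  | Some (r1, t1), Some (r2, t2) =>
      let r1 := val r1 in let r2 := val r2 in let a := angle_dist t1 t2 in
      if pi <= a then r1 + r2
      else Num.sqrt (r1 ^+ 2 + r2 ^+ 2 - 2 * r1 * r2 * cos a)
  | _, _ => kale_radius p + kale_radius q
  end.

Definition kale_open alpha : set (set (kale alpha)) :=
  [set U | forall p, U p ->
    exists2 e : R, 0 < e & forall q, kale_dist p q < e -> U q].

(* The Borel sigma-algebra of the metric kale_dist. *)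
HB.instance Definition _ alpha :=
  Measurable.copy (kale alpha) (g_sigma_algebraType (@kale_open alpha)).

Definition kale_ray alpha (t : circle alpha) : set (kale alpha) :=
  [set kale_polar r t | r in `[0, +oo[].

Definition from_polar (r a : R) : R * R := (r * cos a, r * sin a).

Definition fold_map alpha (t : circle alpha) (p : kale alpha) : R * R :=
  if p is Some (r', t') then
    if angle_dist t t' <= pi then from_polar (val r') (angle_diff t t')
    else from_polar (val r') pi
  else (0, 0).

Section measure.
Context {alpha : R} (mu : probability (kale alpha) R).

Definition kale_integrable : Prop :=
  (\int[mu]_p (kale_dist (apex alpha) p)%:E < +oo)%E.

Definition kale_nondegenerate : Prop :=
  forall t t' : circle alpha, pi <= angle_dist t t' ->
    (mu (kale_ray t `|` kale_ray t') < 1)%E.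

Definition folded_moment (t : circle alpha) : R * R :=
  (\int[mu]_p (fold_map t p).1, \int[mu]_p (fold_map t p).2).

Definition nonneg_angles : set (circle alpha) :=
  [set t | 0 <= (folded_moment t).1].

Definition fully_sticky : Prop := nonneg_angles = set0.

Definition partly_sticky : Prop :=
  nonneg_angles !=set0 /\
  forall t, nonneg_angles t -> (folded_moment t).1 = 0.

Definition nonsticky : Prop :=
  nonneg_angles° !=set0 /\
  forall t, nonneg_angles° t -> 0 < (folded_moment t).1.

End measure.

End kale.

Definition strictly_concave_on {R : realType} (D : set R) (f : R -> R) : Prop :=
  forall x y, D x -> D y -> x != y -> forall s, 0 < s < 1 ->
    s * f x + (1 - s) * f y < f (s * x + (1 - s) * y).

(* Main.v *)
(* The first coordinate of the folding map at angle t sends (r, t') to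
   r cos (min |t' - t| pi), which is 1-Lipschitz in the point, hence measurable.
   As a function of t it satisfies pointwise
     f(a) sin (b - x) + f(b) sin (x - a) <= f(x) sin (b - a)
   for a <= x <= b <= a + pi, a derivative-free form of f'' + f <= 0, and
   f(t) + f(t') <= 0 when |t - t'| >= pi.  Both survive integration, so they
   hold for the moment m_1.  By nondegeneracy m_1(t) + m_1(t') < 0 when
   |t - t'| > pi, so {m_1 >= 0} lies within distance pi of each of its points,
   and the first inequality makes it an arc, on which m_1 is strictly concave
   if it is positive somewhere.  If the arc is a half circle, m_1 vanishes at both
   ends, so mu lives on the half disc between them, where m_1 is a positive
   multiple of a sine. *)
Require Import Defs.
From mathcomp Require Import all_boot all_order all_algebra.
From mathcomp Require Import all_classical all_reals all_analysis.
From mathcomp Require Import measurable_realfun.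
From mathcomp Require Import ring lra.
Import Order.TTheory GRing.Theory Num.Theory.
Import numFieldNormedType.Exports.
Local Open Scope classical_set_scope.
Local Open Scope ring_scope.

(** * Lifts to the line and the distance on the circle *)

Section circle_theory.
Local Open Scope quotient_scope.
Context {R : realType} (alpha : R).
Implicit Types (x y : R) (t : circle alpha).

Lemma to_circleB x y :
  to_circle alpha (x - y) = to_circle alpha x - to_circle alpha y.
Proof. exact: (raddfB (\pi_(Quotient.quot (multiples alpha)))). Qed.

Lemma to_circleD x y :
  to_circle alpha (x + y) = to_circle alpha x + to_circle alpha y.
Proof. exact: (raddfD (\pi_(Quotient.quot (multiples alpha)))). Qed.

Lemma to_circleN x : to_circle alpha (- x) = - to_circle alpha x.
Proof. exact: (raddfN (\pi_(Quotient.quot (multiples alpha)))). Qed.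

Lemma to_circle_eqP x y : to_circle alpha x = to_circle alpha y <->
  exists n : int, x - y = n%:~R * alpha.
Proof.
have e := Quotient.idealrBE (multiples alpha) x y.
split=> [xy|/asboolP xy]; last first.
  by have : x - y \in multiples alpha by []; rewrite e => /eqP.
have : x - y \in multiples alpha by rewrite e; apply/eqP.
by move=> /asboolP.
Qed.

Lemma to_circle_surj t : exists x, to_circle alpha x = t.
Proof.
exists (repr (t : Quotient.quot (multiples alpha))).
exact: (@reprK R (Quotient.quot (multiples alpha)) t).
Qed.

Lemma to_circle_continuous : continuous (to_circle alpha).
Proof. exact: (@pi_continuous R (Quotient.quot (multiples alpha))). Qed.

Hypothesis alpha_gt0 : 0 < alpha.

Lemma circle_small_lift t :
  exists2 x, to_circle alpha x = t & `|x| <= alpha / 2.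
Proof.
have [y <-] := to_circle_surj t.
(* [n] is an integer nearest to [y / alpha]. *)
pose n := Num.floor (y / alpha + 1 / 2).
exists (y - n%:~R * alpha).
  by apply/to_circle_eqP; exists (- n); rewrite rmorphN/= mulNr; ring.
have /andP[h1 h2] := floor_itv (y / alpha + 1 / 2).
rewrite -/n in h1 h2; rewrite rmorphD/= in h2.
have yE : y = y / alpha * alpha by rewrite divfK// gt_eqF.
rewrite yE -mulrBl normrM (gtr0_norm alpha_gt0) mulrC ler_pM2l//.
by rewrite ler_norml; apply/andP; split; lra.
Qed.

(** Distinct lifts differ by a nonzero multiple of [alpha], so the triangle inequality applies to
    [x - y]. *)
Lemma lift_norm_ge x y : to_circle alpha x = to_circle alpha y ->
  x = y \/ alpha <= `|x| + `|y|.
Proof.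
move=> /to_circle_eqP[n xy].
have [n0|n0] := eqVneq n 0.
  by left; apply/eqP; rewrite -subr_eq0 xy n0 mul0r.
right; apply: le_trans (ler_normB x y); rewrite xy normrM (gtr0_norm alpha_gt0).
by rewrite ler_peMl ?(ltW alpha_gt0)// norm_intr_ge1// intr_eq0.
Qed.

Lemma angle_dist_le t1 t2 x :
  to_circle alpha x = t2 - t1 -> angle_dist t1 t2 <= `|x|.
Proof.
move=> xt; apply: ge_inf; last by exists x.
by exists 0 => _ [y _ <-].
Qed.

(** By [lift_norm_ge], any other lift has absolute value at least [alpha / 2], so a lift this short
    attains the infimum. *)
Lemma angle_dist_small t1 t2 x : to_circle alpha x = t2 - t1 ->
  `|x| <= alpha / 2 -> angle_dist t1 t2 = `|x|.
Proof.
move=> xt xa; apply/eqP; rewrite eq_le angle_dist_le//=.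
apply: lb_le_inf; first by exists `|x|, x.
move=> _ [y yt <-]; rewrite /= -xt in yt.
case: (lift_norm_ge _ _ yt) => [->//|]; lra.
Qed.

Lemma angle_dist_lift t1 t2 : exists2 x,
  to_circle alpha x = t2 - t1 & `|x| = angle_dist t1 t2.
Proof.
have [x xt xa] := circle_small_lift (t2 - t1).
by exists x => //; rewrite (angle_dist_small _ _ _ xt xa).
Qed.

Lemma angle_dist_lift_from x t : exists2 y,
  to_circle alpha y = t & `|y - x| = angle_dist (to_circle alpha x) t.
Proof.
have [z zt zd] := angle_dist_lift (to_circle alpha x) t.
exists (x + z); last by rewrite -zd addrC addKr.
by rewrite to_circleD zt addrC subrK.
Qed.

Lemma angle_dist_le_lift x y :
  angle_dist (to_circle alpha x) (to_circle alpha y) <= `|x - y|.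
Proof. by rewrite distrC; apply: angle_dist_le; rewrite to_circleB. Qed.

Lemma angle_dist_ge0 t1 t2 : 0 <= angle_dist t1 t2.
Proof. by have [x _ <-] := angle_dist_lift t1 t2. Qed.

Lemma angle_distC t1 t2 : angle_dist t1 t2 = angle_dist t2 t1.
Proof.
suff h (u v : circle alpha) : angle_dist u v <= angle_dist v u.
  by apply/eqP; rewrite eq_le !h.
have [x xt <-] := angle_dist_lift v u.
by rewrite -normrN; apply: angle_dist_le; rewrite to_circleN xt opprB.
Qed.

Lemma angle_dist_triangle t2 t1 t3 :
  angle_dist t1 t3 <= angle_dist t1 t2 + angle_dist t2 t3.
Proof.
have [x xt <-] := angle_dist_lift t1 t2.
have [y yt <-] := angle_dist_lift t2 t3.
apply: le_trans (ler_normD x y); apply: angle_dist_le.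
by rewrite to_circleD xt yt addrC addrA subrK.
Qed.

Lemma angle_dist0 t1 t2 : angle_dist t1 t2 = 0 -> t1 = t2.
Proof.
have [x xt <-] := angle_dist_lift t1 t2 => /normr0_eq0 x0.
have z : to_circle alpha 0 = 0 by rewrite -(subrr 0) to_circleB subrr.
by apply/esym/eqP; rewrite -subr_eq0 -xt x0 z.
Qed.

Lemma angle_dist_ge_lift x y :
  alpha - `|x - y| <= angle_dist (to_circle alpha x) (to_circle alpha y) \/
  angle_dist (to_circle alpha x) (to_circle alpha y) = `|x - y|.
Proof.
have [z zt <-] := angle_dist_lift (to_circle alpha x) (to_circle alpha y).
rewrite -to_circleB in zt; rewrite [`|x - y|]distrC.
by case: (lift_norm_ge _ _ zt) => [->|]; [right|left; lra].
Qed.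

End circle_theory.

(** * Monotonicity, concavity and Lipschitz facts on sine and cosine *)

Section trigonometry.
Context {R : realType}.
Implicit Types x y s : R.

Lemma ler_cos_0pi x y : 0 <= x -> x <= y -> y <= pi -> cos y <= cos x.
Proof.
move=> x0; rewrite le_eqVlt => /predU1P[->//|xy] ypi; apply: ltW.
by rewrite ltr_cos// in_itv/=; apply/andP; split; lra.
Qed.

Lemma sin_eq0_0pi x : 0 <= x <= pi -> sin x = 0 -> x = 0 \/ x = pi.
Proof.
move=> /andP[]; rewrite !le_eqVlt => /predU1P[<-|x0]; first by left.
move=> /predU1P[->|xpi]; first by right.
by move=> s0; have := @sin_gt0_pi R x; rewrite x0 xpi s0 ltxx => /(_ isT).
Qed.

(** This is strict concavity of sine on [[0, x]]: the mean value theorem on [[0, s * x]] and on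
    [[s * x, x]] gives two slopes, and cosine decreases strictly from one to the other. *)
Lemma sin_mul_lt x s : 0 < x < pi -> 0 < s < 1 -> s * sin x < sin (s * x).
Proof.
move=> /andP[x0 xpi] /andP[s0 s1].
have sx0 : 0 < s * x by rewrite mulr_gt0.
have sxx : s * x < x by rewrite gtr_pMl.
have [u + eu] := MVT sx0 (fun z _ => is_derive_sin z)
  (continuous_subspaceT (@continuous_sin R)).
have [v + ev] := MVT sxx (fun z _ => is_derive_sin z)
  (continuous_subspaceT (@continuous_sin R)).
rewrite !in_itv/= => /andP[v1 v2] /andP[u1 u2].
rewrite sin0 !subr0 in eu.
have vu : cos v < cos u.
  by rewrite ltr_cos ?in_itv/=; [lra|apply/andP; split; lra..].
have : s * (x - s * x) * cos v < s * (x - s * x) * cos u.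
  by rewrite ltr_pM2l// mulr_gt0// subr_gt0.
have -> : s * (x - s * x) * cos u = (1 - s) * sin (s * x) by rewrite eu; ring.
have -> : s * (x - s * x) * cos v = s * (sin x - sin (s * x)).
  by rewrite ev; ring.
lra.
Qed.

Lemma cos_lip x y : `|cos x - cos y| <= `|x - y|.
Proof.
wlog yx : x y / y <= x.
  move=> h; have [/h//|/ltW/h] := leP y x.
  by rewrite distrC [leRHS]distrC.
have [u _ ->] := MVT_segment yx (fun z _ => is_derive_cos z)
  (continuous_subspaceT (@continuous_cos R)).
by rewrite normrM normrN ler_piMl// sin_max.
Qed.

End trigonometry.

(** * The angular factor of the first folded coordinate *)

Section fold_cos.
Context {R : realType} (alpha : R).
Hypothesis halpha : 2 * pi < alpha.
Implicit Types (x y a b : R) (t : circle alpha).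
Local Notation c := (to_circle alpha).

(** Capping the distance at [pi] merges the two branches of [fold_map]: beyond [pi] every point
    folds onto the negative axis. *)
Definition fold_cos t1 t2 : R := cos (Num.min (angle_dist t1 t2) pi).

Let alpha_gt0 : 0 < alpha.
Proof. by move: halpha (@pi_gt0 R); lra. Qed.

Lemma min_angle_itv t1 t2 : 0 <= Num.min (angle_dist t1 t2) pi <= pi.
Proof.
by rewrite le_min angle_dist_ge0//= pi_ge0 ge_min lexx orbT.
Qed.

Lemma fold_cos_le t1 t2 x : 0 <= x <= pi -> x <= angle_dist t1 t2 ->
  fold_cos t1 t2 <= cos x.
Proof.
move=> /andP[x0 xpi] xd; apply: ler_cos_0pi => //.
  by rewrite le_min xd.
by have /andP[] := min_angle_itv t1 t2.
Qed.

Lemma fold_cos_ge x y : `|x - y| <= pi -> cos (x - y) <= fold_cos (c x) (c y).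
Proof.
move=> xy; rewrite -[leLHS]cos_norm; apply: ler_cos_0pi => //.
  by have /andP[] := min_angle_itv (c x) (c y).
by rewrite ge_min angle_dist_le_lift.
Qed.

(** Beyond [pi], the right-hand side is the cosine of [2 * pi - |x - y|], and the circle distance is
    at least that: it is either [|x - y|] or at least [alpha - |x - y|]. *)
Lemma fold_cos_le_cos x y : `|x - y| <= 2 * pi ->
  fold_cos (c x) (c y) <= cos (x - y).
Proof.
move=> xy; have d := angle_dist_ge_lift _ alpha_gt0 x y.
have n0 := normr_ge0 (x - y).
rewrite -[leRHS]cos_norm; have [xpi|xpi] := leP `|x - y| pi.
  apply: fold_cos_le; first by rewrite n0.
  by case: d => [|->//]; move: halpha; lra.
rewrite -[leRHS]cosN -cosD2pi mulr2n.
apply: fold_cos_le; first by apply/andP; split; lra.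
by case: d => [|->]; move: halpha; lra.
Qed.

Lemma fold_cos_lift x y : `|x - y| <= pi -> fold_cos (c x) (c y) = cos (x - y).
Proof.
move=> xy; apply/eqP; rewrite eq_le fold_cos_ge// fold_cos_le_cos//.
by have := @pi_gt0 R; lra.
Qed.

(** Let [q] be a lift of [t] closest to [x]. If [q] is within [pi] of [x], the value at [x] is a
    cosine, cosines bound the values at [a] and [b] from above, and for cosines equality holds by
    the addition formulas. Otherwise the value at [x] is -1, and the triangle inequality keeps [t]
    at distance at least [pi - (x - a)] from [a] and [pi - (b - x)] from [b]. *)
Lemma fold_cos_three_point a b x t : a <= x -> x <= b -> b - a <= pi ->
  fold_cos (c a) t * sin (b - x) + fold_cos (c b) t * sin (x - a)
    <= fold_cos (c x) t * sin (b - a).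
Proof.
move=> ax xb ab.
have sbx : 0 <= sin (b - x) by apply: sin_ge0_pi; apply/andP; split; lra.
have sxa : 0 <= sin (x - a) by apply: sin_ge0_pi; apply/andP; split; lra.
have [q <- qd] := angle_dist_lift_from _ alpha_gt0 x t.
have [xpi|xpi] := leP (angle_dist (c x) (c q)) pi.
  rewrite [fold_cos (c x) _]fold_cos_lift; last by rewrite distrC qd.
  rewrite distrC in qd; rewrite -qd ler_norml in xpi.
  move: xpi => /andP[l u].
  have ha : fold_cos (c a) (c q) <= cos (a - q).
    by apply: fold_cos_le_cos; rewrite ler_norml; apply/andP; split; lra.
  have hb : fold_cos (c b) (c q) <= cos (b - q).
    by apply: fold_cos_le_cos; rewrite ler_norml; apply/andP; split; lra.
  apply: le_trans (lerD (ler_wpM2r sbx ha) (ler_wpM2r sxa hb)) _.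
  have -> : b - a = (b - x) + (x - a) by ring.
  have -> : a - q = (x - q) - (x - a) by ring.
  have -> : b - q = (x - q) + (b - x) by ring.
  move: (x - q) (x - a) (b - x) => y v w.
  by rewrite sinD cosB cosD; lra.
have -> : fold_cos (c x) (c q) = - 1.
  by rewrite /fold_cos min_r ?cospi// ltW.
have ha : fold_cos (c a) (c q) <= cos (pi - (x - a)).
  apply: fold_cos_le; first by apply/andP; split; lra.
  have := angle_dist_triangle _ alpha_gt0 (c a) (c x) (c q).
  have := angle_dist_le_lift alpha x a; rewrite ger0_norm; lra.
have hb : fold_cos (c b) (c q) <= cos (pi - (b - x)).
  apply: fold_cos_le; first by apply/andP; split; lra.
  have := angle_dist_triangle _ alpha_gt0 (c b) (c x) (c q).
  have := angle_dist_le_lift alpha x b; rewrite ler0_norm; lra.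
apply: le_trans (lerD (ler_wpM2r sbx ha) (ler_wpM2r sxa hb)) _.
have -> : b - a = (b - x) + (x - a) by ring.
by move: (x - a) (b - x) => v w; rewrite sinD !cosB cospi sinpi; lra.
Qed.

(** With [m] the capped distance from [t2] to [t], the triangle inequality puts [t] at distance at
    least [pi - m] from [t1], and the cosine of [pi - m] is the opposite of that of [m]. *)
Lemma fold_cos_antipodal t1 t2 t : pi <= angle_dist t1 t2 ->
  fold_cos t1 t + fold_cos t2 t <= 0.
Proof.
move=> d12; rewrite -lerBrDr sub0r.
have /andP[m0 mpi] := min_angle_itv t2 t.
rewrite [X in _ <= - X]/fold_cos -[in leRHS]cosN -cosDpi.
apply: fold_cos_le; first by apply/andP; split; lra.
have := angle_dist_triangle _ alpha_gt0 t t1 t2.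
rewrite [angle_dist t t2]angle_distC// minEle; case: ifPn => _; last first.
  by have := angle_dist_ge0 _ alpha_gt0 t1 t; lra.
lra.
Qed.

Lemma fold_cos_sum0 t1 t2 t : fold_cos t1 t + fold_cos t2 t = 0 ->
  Num.min (angle_dist t1 t) pi + Num.min (angle_dist t2 t) pi = pi.
Proof.
have m1 := min_angle_itv t1 t; have m2 := min_angle_itv t2 t.
move=> /eqP; rewrite addr_eq0 /fold_cos => /eqP e.
suff -> : Num.min (angle_dist t1 t) pi = pi - Num.min (angle_dist t2 t) pi.
  by rewrite subrK.
apply: cos_inj; rewrite ?in_itv//=.
  by move: m2 => /andP[? ?]; apply/andP; split; lra.
by rewrite e cosB cospi sinpi; ring.
Qed.

Lemma min_angle_sum t1 t2 t : pi <= angle_dist t1 t2 ->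
  Num.min (angle_dist t1 t) pi = pi ->
  fold_cos t1 t + fold_cos t2 t = 0 -> t = t2.
Proof.
move=> d12 e /fold_cos_sum0; rewrite e => e2.
apply/esym/(angle_dist0 _ alpha_gt0); move: e2.
by rewrite minEle; case: ifPn; have := @pi_gt0 R; lra.
Qed.

(** Equality makes the capped distances add up to [pi]. If neither is capped, this contradicts the
    triangle inequality; if one is [pi], the other is 0. *)
Lemma fold_cos_antipodal_eq0 t1 t2 t : pi < angle_dist t1 t2 ->
  fold_cos t1 t + fold_cos t2 t = 0 -> t = t1 \/ t = t2.
Proof.
move=> d12 s0; have [h|h] := leP pi (angle_dist t1 t).
  by right; apply: (min_angle_sum t1) => //; [exact: ltW|rewrite min_r].
have [h'|h'] := leP pi (angle_dist t2 t).
  left; apply: (min_angle_sum t2); rewrite ?min_r// 1?addrC//.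
  by rewrite angle_distC// ltW.
have := fold_cos_sum0 _ _ _ s0; rewrite !min_l ?(ltW h) ?(ltW h')//.
have := angle_dist_triangle _ alpha_gt0 t t1 t2.
rewrite (angle_distC _ alpha_gt0 t t2).
by move=> ? ?; exfalso; lra.
Qed.

Lemma angle_dist_pi a : angle_dist (c a) (c (a + pi)) = pi.
Proof.
rewrite (angle_dist_small _ alpha_gt0 _ _ pi) ?ger0_norm ?pi_ge0//; last first.
  by move: halpha; lra.
by rewrite -to_circleB addrC addKr.
Qed.

(** In the equality case for the endpoints of a half circle, [t] lies on that half circle, at its
    distance from [a]. *)
Lemma half_circle_lift a t : fold_cos (c a) t + fold_cos (c (a + pi)) t = 0 ->
  t = c (a + Num.min (angle_dist (c a) t) pi).
Proof.
move=> s0; have [h|h] := leP pi (angle_dist (c a) t).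
  by rewrite (min_angle_sum (c a) (c (a + pi)) t)// ?min_r ?angle_dist_pi// .
have := fold_cos_sum0 _ _ _ s0.
have [q qt qd] := angle_dist_lift_from _ alpha_gt0 a t.
rewrite -{}qt in s0 h qd *; rewrite (min_l (ltW h)).
have [qa|qa] := leP 0 (q - a).
  by move=> _; congr c; rewrite -qd ger0_norm//; ring.
(* A lift [q] to the left of [a], at distance [d], is impossible: its distance to [a + pi] should be
   [pi - d], but it is [pi + d] or at least [alpha - pi - d]. *)
rewrite ltr0_norm// in qd.
have := angle_dist_ge_lift _ alpha_gt0 (a + pi) q.
rewrite ger0_norm; last by have := @pi_gt0 R; lra.
move=> e1 e2; exfalso; move: e1 e2 halpha qd qa.
by rewrite minEle; case: ifPn => ? [] ? ? ? ? ?; lra.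
Qed.

(** By [half_circle_lift] no capping or wrapping occurs, so this is the subtraction formula for the
    cosine. *)
Lemma fold_cos_half_circle a x t :
  fold_cos (c a) t + fold_cos (c (a + pi)) t = 0 -> a <= x -> x <= a + pi ->
  fold_cos (c x) t = cos (x - a) * fold_cos (c a) t
    + sin (x - a) * sin (Num.min (angle_dist (c a) t) pi).
Proof.
move=> /half_circle_lift; have := min_angle_itv (c a) t.
rewrite {2}/fold_cos; set d := Num.min _ _ => /andP[d0 dpi] -> ax xb.
rewrite fold_cos_lift; last by rewrite ler_norml; apply/andP; split; lra.
by rewrite -cosB; congr cos; ring.
Qed.

Lemma fold_cos_lip t1 t2 t :
  `|fold_cos t1 t - fold_cos t2 t| <= angle_dist t1 t2.
Proof.
apply: le_trans (cos_lip _ _) _.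
have := angle_dist_triangle _ alpha_gt0 t2 t1 t.
have := angle_dist_triangle _ alpha_gt0 t1 t2 t.
rewrite [angle_dist t2 t1]angle_distC// ler_norml !minEle => h1 h2.
by apply/andP; split; case: ifPn => ?; case: ifPn => ?; lra.
Qed.

End fold_cos.

(** * Equality cases of integrated inequalities *)

Section ae_integral.
Context d (T : measurableType d) (R : realType).
Context (mu : {measure set T -> \bar R}).

Lemma ae_eq0_Rintegral_le0 (w : T -> R) :
  mu.-integrable setT (EFin \o w) -> {ae mu, forall x, 0 <= w x} ->
  \int[mu]_x w x <= 0 -> {ae mu, forall x, w x = 0}.
Proof.
move=> iw w0 le0.
have mw := measurable_int _ iw.
have aw : ae_eq mu setT (EFin \o w) (fun x => `|(EFin \o w) x|%E).
  by apply: filterS w0 => x w0 _ /=; rewrite ger0_norm.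
have ew : (\int[mu]_x (EFin \o w) x = \int[mu]_x `|(EFin \o w) x|)%E.
  by apply: ae_eq_integral => //; exact: measurableT_comp.
have : (\int[mu]_x `|(EFin \o w) x| = 0)%E.
  apply/eqP; rewrite eq_le integral_ge0// andbT -ew.
  have fi := integrable_fin_num measurableT iw.
  by rewrite -(fineK fi) lee_fin.
move=> /(ae_eq_integral_abs mu measurableT mw).
by apply: filterS => x /(_ I) [].
Qed.

End ae_integral.

(** * Lipschitz bounds and measurability on the kale *)

Section kale_theory.
Context {R : realType} (alpha : R).
Hypothesis halpha : 2 * pi < alpha.
Implicit Types (t : circle alpha) (p q : kale alpha).

Let alpha_gt0 : 0 < alpha.
Proof. by move: halpha (@pi_gt0 R); lra. Qed.

(* The angle of the apex is a junk value. *)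
Definition kale_angle p : circle alpha := if p is Some (_, t) then t else 0.

Lemma kale_radius_ge0 p : 0 <= kale_radius p.
Proof. by case: p => [[r t]|]//=; exact: ltW (valP r). Qed.

Lemma fold_map1E t p :
  (fold_map t p).1 = kale_radius p * fold_cos alpha t (kale_angle p).
Proof.
case: p => [[r t']|]/=; last by rewrite mul0r.
case: ifPn => [dpi|]; last first.
  by rewrite -ltNge => /ltW dpi; rewrite /= /fold_cos min_r.
rewrite /= /fold_cos min_l//; congr (_ * _).
(* Since [pi] is below [alpha / 2], the absolute value of a representative in [[-pi, pi]] is the
   circle distance; the default value 0 of [xget] is never taken. *)
rewrite /angle_diff; case: xgetP => [x _ [/andP[x1 x2] xt]|h].
  rewrite (angle_dist_small _ alpha_gt0 _ _ x)//; first by rewrite cos_norm.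
  by rewrite ler_norml; apply/andP; split; move: halpha; lra.
have [x xt xd] := angle_dist_lift _ alpha_gt0 t t'.
by case: (h x); split => //; rewrite -ler_norml xd.
Qed.

Lemma norm_fold_map1 t p : `|(fold_map t p).1| <= kale_radius p.
Proof.
rewrite fold_map1E normrM (ger0_norm (kale_radius_ge0 p)).
by rewrite ler_piMr ?kale_radius_ge0// cos_max.
Qed.

Lemma mem_kale_ray t p : kale_radius p = 0 \/ kale_angle p = t -> kale_ray t p.
Proof.
case: p => [[r t']|]/=; last first.
  move=> _; exists 0; first by rewrite /= in_itv/= lexx.
  by rewrite /kale_polar insubF// ltxx.
case=> [r0|->]; first by have := valP r; rewrite /= r0 ltxx.
exists (val r); first by rewrite /= in_itv/= andbT ltW// (valP r).
by rewrite /kale_polar valK.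
Qed.

(** The factor [1 - cos] vanishes only at capped distance 0. Writing a ray as the zero set of a
    measurable function is what makes it measurable. *)
Lemma kale_rayE t :
  kale_ray t = [set p | kale_radius p - (fold_map t p).1 = 0].
Proof.
apply/seteqP; split => [_ [r r0 <-]|p /=].
  suff h p : kale_angle p = t -> kale_radius p - (fold_map t p).1 = 0.
    rewrite /kale_polar; case: insubP => [s _ _|_]; first exact: h.
    by rewrite /= subr0.
  move=> pt.
  rewrite fold_map1E pt /fold_cos (_ : angle_dist t t = 0); last first.
    rewrite (angle_dist_small _ alpha_gt0 _ _ 0) ?normr0//; last first.
      by rewrite divr_ge0 ?ltW.
    by rewrite -(subrr 0) to_circleB !subrr.
  by rewrite min_l ?pi_ge0// cos0 mulr1 subrr.
rewrite fold_map1E -{1}[kale_radius p]mulr1 -mulrBr => /eqP; rewrite mulf_eq0.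
move=> /orP[/eqP ?|c1]; apply: mem_kale_ray; [by left|right].
move: c1; rewrite subr_eq0 => /eqP c1.
have m0 : Num.min (angle_dist t (kale_angle p)) pi = 0.
  apply: cos_inj; rewrite ?in_itv/= ?lexx ?pi_ge0 ?min_angle_itv//.
  by rewrite cos0 c1.
apply/esym/(angle_dist0 _ alpha_gt0); move: m0.
rewrite minEle; case: ifPn => // _ e.
by have := @pi_gt0 R; rewrite e ltxx.
Qed.

(** For planar points with polar coordinates [(r1, x1)] and [(r2, x2)], the first coordinates differ
    by at most the planar distance, which by the law of cosines grows with the angle between them.
    Zero angles give the bound for the radius, capped distances to a fixed angle that for the
    folding map. *)
Lemma norm_sub_proj_le (r1 r2 x1 x2 : R) t1 t2 : 0 <= r1 -> 0 <= r2 ->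
  `|x1 - x2| <= angle_dist t1 t2 ->
  angle_dist t1 t2 <= pi ->
  `|r1 * cos x1 - r2 * cos x2| <=
    Num.sqrt (r1 ^+ 2 + r2 ^+ 2 - 2 * r1 * r2 * cos (angle_dist t1 t2)).
Proof.
move=> r10 r20 xd dpi; rewrite -sqrtr_sqr; apply: ler_wsqrtr.
have cd : cos (angle_dist t1 t2) <= cos x1 * cos x2 + sin x1 * sin x2.
  by rewrite -cosB -[leRHS]cos_norm; apply: ler_cos_0pi.
have : 0 <= (r1 * sin x1 - r2 * sin x2) ^+ 2 by exact: sqr_ge0.
have := cos2Dsin2 x1; have := cos2Dsin2 x2.
have : r1 * r2 * cos (angle_dist t1 t2)
    <= r1 * r2 * (cos x1 * cos x2 + sin x1 * sin x2).
  by rewrite ler_wpM2l// mulr_ge0.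
move: (cos x1) (cos x2) (sin x1) (sin x2) => c1 c2 s1 s2.
move: (cos (angle_dist t1 t2)) => k.
move=> h e2 e1.
have -> : r1 ^+ 2 + r2 ^+ 2
    = r1 ^+ 2 * (c1 ^+ 2 + s1 ^+ 2) + r2 ^+ 2 * (c2 ^+ 2 + s2 ^+ 2).
  by rewrite e1 e2 !mulr1.
by move: h; rewrite !expr2; lra.
Qed.

Lemma kale_radius_lip p q : `|kale_radius p - kale_radius q| <= kale_dist p q.
Proof.
have := kale_radius_ge0 p; have := kale_radius_ge0 q.
case: p => [[r1 t1]|]; case: q => [[r2 t2]|] /= ? ?;
  try (rewrite ler_norml; apply/andP; split; lra).
case: ifPn => [_|]; first by rewrite ler_norml; apply/andP; split; lra.
rewrite -ltNge => /ltW h.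
have := norm_sub_proj_le (val r1) (val r2) 0 0 t1 t2.
by rewrite cos0 !mulr1 subr0 normr0; apply=> //; exact: angle_dist_ge0.
Qed.

Lemma fold_map1_lip t p q :
  `|(fold_map t p).1 - (fold_map t q).1| <= kale_dist p q.
Proof.
have := norm_fold_map1 t p; have := norm_fold_map1 t q; rewrite !fold_map1E.
have := kale_radius_ge0 p; have := kale_radius_ge0 q.
(* When the kale distance is at least the sum of the radii (a point is the apex, or the path passes
   through it), bounding each coordinate by its radius suffices. *)
have tri : kale_radius p + kale_radius q <= kale_dist p q ->
  `|kale_radius q * fold_cos alpha t (kale_angle q)| <= kale_radius q ->
  `|kale_radius p * fold_cos alpha t (kale_angle p)| <= kale_radius p ->
  `|kale_radius p * fold_cos alpha t (kale_angle p)
    - kale_radius q * fold_cos alpha t (kale_angle q)| <= kale_dist p q.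
  by move=> h ? ?; apply: le_trans (ler_normB _ _) _; lra.
case: p tri => [[r1 t1]|] tri; case: q tri => [[r2 t2]|] tri /= ? ?;
  try exact: tri.
move: tri => /=; case: ifPn => [_|]; first by apply.
rewrite -ltNge => /ltW h _ _ _.
apply: norm_sub_proj_le => //.
have h1 := angle_dist_triangle _ alpha_gt0 t1 t t2.
have := angle_dist_triangle _ alpha_gt0 t2 t t1.
rewrite [angle_dist t2 t1]angle_distC// ler_norml !minEle => h2.
by apply/andP; split; case: ifPn => ?; case: ifPn => ?; lra.
Qed.

(** The preimage of an open ray []x, +oo[] is open: it contains the ball of radius [u p - x] around
    each of its points [p]. *)
Lemma kale_lip_measurable (u : kale alpha -> R) :
  (forall p q, `|u p - u q| <= kale_dist p q) -> measurable_fun setT u.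
Proof.
move=> ulip; apply: (measurability _ (RGenOInfty.measurableE R)) => //.
move=> _ [_ [x ->] <-]; rewrite setTI; apply: sub_sigma_algebra => p /=.
rewrite in_itv/= andbT => xp; exists (u p - x); first by rewrite subr_gt0.
move=> q pq; rewrite in_itv/= andbT.
have := ulip p q; have := ler_norm (u p - u q); lra.
Qed.

Lemma measurable_kale_radius : measurable_fun setT (@kale_radius R alpha).
Proof. by apply: kale_lip_measurable; exact: kale_radius_lip. Qed.

Lemma measurable_fold_map1 t : measurable_fun setT (fun p => (fold_map t p).1).
Proof. by apply: kale_lip_measurable; exact: fold_map1_lip. Qed.

Lemma measurable_kale_ray t : measurable (kale_ray t).
Proof.
have m : measurable_fun setT (fun p => kale_radius p - (fold_map t p).1).
  apply: measurable_funB; first exact: measurable_kale_radius.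
  exact: measurable_fold_map1.
have := m measurableT [set 0] (measurable_set1 0).
by rewrite setTI kale_rayE.
Qed.

End kale_theory.

(** * Inequalities for the first folded moment *)

Section moment.
Context {R : realType} (alpha : R).
Hypothesis halpha : 2 * pi < alpha.
Context (mu : probability (kale alpha) R).
Hypothesis hint : kale_integrable mu.
Hypothesis hnd : kale_nondegenerate mu.
Implicit Types (t : circle alpha) (p q : kale alpha) (x y a b : R).
Local Notation c := (to_circle alpha).
Local Notation M t := (folded_moment mu t).1.

Let alpha_gt0 : 0 < alpha.
Proof. by move: halpha (@pi_gt0 R); lra. Qed.

Lemma integrable_kale_radius :
  mu.-integrable setT (EFin \o (@kale_radius R alpha)).
Proof.
apply/integrableP; split.
  by apply/measurable_EFinP; exact: measurable_kale_radius.
apply: le_lt_trans hint; under eq_integral => p _.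
  rewrite /= ger0_norm ?kale_radius_ge0// -[kale_radius p]add0r.
over.
by [].
Qed.

Lemma integrable_fold_map1 t :
  mu.-integrable setT (EFin \o (fun p => (fold_map t p).1)).
Proof.
apply: le_integrable integrable_kale_radius => //.
  by apply/measurable_EFinP; exact: measurable_fold_map1.
move=> p _ /=; rewrite lee_fin [leRHS]ger0_norm ?kale_radius_ge0//.
exact: norm_fold_map1.
Qed.

Lemma integrable_comb (u v : R) t1 t2 :
  mu.-integrable setT
    (EFin \o (fun p => u * (fold_map t1 p).1 + v * (fold_map t2 p).1)).
Proof.
apply: (@integrableD _ _ _ mu _ measurableT 
  (fun p => (u * (fold_map t1 p).1)%:E) (fun p => (v * (fold_map t2 p).1)%:E));
  exact: (integrableZl measurableT _ (integrable_fold_map1 _)).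
Qed.

Lemma moment_comb (u v : R) t1 t2 :
  \int[mu]_p (u * (fold_map t1 p).1 + v * (fold_map t2 p).1)
    = u * M t1 + v * M t2.
Proof.
rewrite RintegralD//;
  try exact: (integrableZl measurableT _ (integrable_fold_map1 _)).
by rewrite !RintegralZl//; exact: integrable_fold_map1.
Qed.

Lemma moment_three_point a b x : a <= x -> x <= b -> b - a <= pi ->
  M (c a) * sin (b - x) + M (c b) * sin (x - a) <= M (c x) * sin (b - a).
Proof.
move=> ax xb ab; rewrite ![_ * sin _]mulrC.
rewrite -moment_comb.
rewrite -RintegralZl//; last exact: integrable_fold_map1.
apply: le_Rintegral => //; first exact: integrable_comb.
  exact: (integrableZl measurableT _ (integrable_fold_map1 _)).
move=> p _; rewrite !(fold_map1E _ halpha).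
have := fold_cos_three_point _ halpha _ _ _ (kale_angle alpha p) ax xb ab.
move=> /(ler_wpM2l (kale_radius_ge0 _ p)).
by rewrite mulrDr ![kale_radius p * (_ * _)]mulrA ![_ * sin _]mulrC.
Qed.

Lemma moment_lip t1 t2 :
  `|M t1 - M t2| <= angle_dist t1 t2 * \int[mu]_p kale_radius p.
Proof.
rewrite -(mulN1r (M t2)) -{1}(mul1r (M t1)) -moment_comb.
 apply: le_trans (le_normr_Rintegral measurableT _) _.
  exact: integrable_comb.
rewrite -RintegralZl//; last exact: integrable_kale_radius.
apply: le_Rintegral => //.
- exact: (integrable_abse (integrable_comb _ _ _ _)).
- exact: (integrableZl measurableT _ integrable_kale_radius).
move=> p _; rewrite !(fold_map1E _ halpha) mul1r mulN1r -mulrBr normrM mulrC.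
rewrite (ger0_norm (kale_radius_ge0 _ p)).
by rewrite ler_wpM2r ?kale_radius_ge0// fold_cos_lip.
Qed.

Lemma moment_continuous : continuous (fun x => M (c x)).
Proof.
move=> x; apply/cvgrPdist_lt => e e0.
set I := \int[mu]_p kale_radius p.
have I0 : 0 <= I by apply: Rintegral_ge0 => p _; exact: kale_radius_ge0.
(* Adding 1 keeps the denominator positive when the mean radius [I] is 0. *)
have d0 : 0 < e / (I + 1) by rewrite divr_gt0// ltr_wpDl.
near=> y.
apply: le_lt_trans (moment_lip _ _) _; rewrite -/I.
have xy : `|x - y| < e / (I + 1).
  by near: y; apply: cvgr_dist_lt => //; exact: cvg_id.
apply: le_lt_trans (ler_wpM2r I0 (angle_dist_le_lift _ _ _)) _.
apply: (@le_lt_trans _ _ (`|x - y| * (I + 1))).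
  by rewrite ler_wpM2l// lerDl.
by rewrite -ltr_pdivlMr// ltr_wpDl.
Unshelve. all: by end_near.
Qed.

Lemma fold_map1_antipodal t1 t2 p : pi <= angle_dist t1 t2 ->
  0 <= -1 * (fold_map t1 p).1 + -1 * (fold_map t2 p).1.
Proof.
move=> d12; rewrite !mulN1r -opprD oppr_ge0 !(fold_map1E _ halpha) -mulrDr.
by rewrite mulr_ge0_le0 ?kale_radius_ge0//; exact: fold_cos_antipodal.
Qed.

Lemma moment_antipodal t1 t2 : pi <= angle_dist t1 t2 -> M t1 + M t2 <= 0.
Proof.
move=> d12.
rewrite -oppr_ge0 opprD -(mulN1r (M t1)) -(mulN1r (M t2)) -moment_comb.
by apply: Rintegral_ge0 => p _; exact: fold_map1_antipodal.
Qed.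

(** The integrand of the antipodal inequality has a constant sign, so a nonnegative total forces it
    to vanish almost everywhere. *)
Lemma ae_fold_cos_sum0 t1 t2 : pi <= angle_dist t1 t2 -> 0 <= M t1 + M t2 ->
  {ae mu, forall p, kale_radius p = 0 \/
    fold_cos alpha t1 (kale_angle alpha p)
      + fold_cos alpha t2 (kale_angle alpha p) = 0}.
Proof.
move=> d12 s0.
have iw := integrable_comb (-1) (-1) t1 t2.
have w0 : {ae mu, forall p,
    0 <= -1 * (fold_map t1 p).1 + -1 * (fold_map t2 p).1}.
  by apply: aeW => p; exact: fold_map1_antipodal.
have le0 : \int[mu]_p (-1 * (fold_map t1 p).1 + -1 * (fold_map t2 p).1) <= 0.
  by rewrite moment_comb (mulN1r (M t1)) (mulN1r (M t2)) -opprD oppr_le0.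
apply: filterS (ae_eq0_Rintegral_le0 _ _ _ mu _ iw w0 le0) => p.
rewrite !mulN1r -opprD !(fold_map1E _ halpha) -mulrDr.
by move=> /eqP; rewrite oppr_eq0 mulf_eq0 => /orP[]/eqP; [left|right].
Qed.

(** Otherwise the two rays would have a null complement, hence full measure. In this form
    nondegeneracy excludes the equality cases. *)
Lemma not_ae_rays t1 t2 : pi <= angle_dist t1 t2 ->
  ~ {ae mu, forall p, kale_radius p = 0 \/ kale_angle alpha p = t1 \/
       kale_angle alpha p = t2}.
Proof.
move=> d12 ae; have := hnd _ _ d12.
have mS : measurable (kale_ray t1 `|` kale_ray t2).
  by apply: measurableU; exact: measurable_kale_ray.
suff h : mu (~` (kale_ray t1 `|` kale_ray t2)) = 0.
  rewrite -[X in mu X]setCK probability_setC; last exact: measurableC.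
  by rewrite [X in (_ - X)%E]h sube0 ltxx.
apply/negligibleP; first exact: measurableC.
apply: negligibleS ae => p; apply: contra_not => /= -[p0|[pt|pt]].
- by left; apply: mem_kale_ray; left.
- by left; apply: mem_kale_ray; right.
- by right; apply: mem_kale_ray; right.
Qed.

Lemma moment_antipodal_lt t1 t2 : pi < angle_dist t1 t2 -> M t1 + M t2 < 0.
Proof.
move=> d12; rewrite ltNge; apply/negP => s0.
apply: (not_ae_rays t1 t2 (ltW d12)).
apply: filterS (ae_fold_cos_sum0 _ _ (ltW d12) s0) => p [|s]; first by left.
by right; exact: (fold_cos_antipodal_eq0 _ halpha _ _ _ d12).
Qed.

(** Both end moments vanish, so almost every point lies over the half circle. There the folded
    coordinate at [x] minus [cos (x - a)] times the one at [a] is nonnegative, with integral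
    [M (c x)]. Were this integral at most 0, almost every point would lie on the two end rays. *)
Lemma moment_half_circle a x : 0 <= M (c a) -> 0 <= M (c (a + pi)) ->
  a < x < a + pi -> 0 < M (c x).
Proof.
move=> + + /andP[ax xb].
have sx : 0 < sin (x - a) by apply: sin_gt0_pi; apply/andP; split; lra.
move=> a0 b0.
have dpi := angle_dist_pi _ halpha a.
have d12 : pi <= angle_dist (c a) (c (a + pi)) by rewrite dpi.
have s0 := moment_antipodal _ _ d12.
have Ma : M (c a) = 0.
  by apply/eqP; rewrite eq_le a0 andbT; apply: le_trans s0; rewrite lerDl.
rewrite ltNge; apply/negP => x0.
have ae1 := ae_fold_cos_sum0 _ _ d12 (addr_ge0 a0 b0).
have w p : kale_radius p = 0 \/
    fold_cos alpha (c a) (kale_angle alpha p)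
      + fold_cos alpha (c (a + pi)) (kale_angle alpha p) = 0 ->
  1 * (fold_map (c x) p).1 + - cos (x - a) * (fold_map (c a) p).1 =
  sin (x - a) * (kale_radius p *
    sin (Num.min (angle_dist (c a) (kale_angle alpha p)) pi)).
  rewrite !(fold_map1E _ halpha); case=> [->|s]; first by rewrite !mul0r; ring.
  by rewrite (fold_cos_half_circle _ halpha a x _ s (ltW ax) (ltW xb)); ring.
have s p : 0 <= sin (Num.min (angle_dist (c a) (kale_angle alpha p)) pi).
  by apply: sin_ge0_pi; exact: min_angle_itv.
have iw := integrable_comb 1 (- cos (x - a)) (c x) (c a).
have le0 : \int[mu]_p (1 * (fold_map (c x) p).1
    + - cos (x - a) * (fold_map (c a) p).1) <= 0.
  by rewrite moment_comb Ma mulr0 addr0 mul1r.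
have ae3 : {ae mu, forall p, 1 * (fold_map (c x) p).1
    + - cos (x - a) * (fold_map (c a) p).1 = 0}.
  apply: (ae_eq0_Rintegral_le0 _ _ _ mu _ iw _ le0).
  apply: filterS ae1 => p /w e; rewrite e; apply: mulr_ge0; first exact: ltW.
  by apply: mulr_ge0; first exact: kale_radius_ge0.
apply: (not_ae_rays _ _ d12); apply: filterS2 ae1 ae3 => p h.
rewrite (w p h) => /eqP; rewrite mulf_eq0 (gt_eqF sx)/= mulf_eq0.
case: h => [|h]; first by left.
move=> /orP[/eqP|/eqP]; first by left.
(* A vanishing sine puts the angle at one end of the half circle. *)
move=> /(sin_eq0_0pi _ (min_angle_itv _ halpha _ _)) e; right.
have := half_circle_lift _ halpha _ _ h.
by case: e => ->; rewrite ?addr0; [left|right].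
Qed.

End moment.

(** * Functions on the line that satisfy the three-point inequality *)

Section sine_concave.
Context {R : realType} (f : R -> R).
Hypothesis f_three_point : forall a b x, a <= x -> x <= b -> b - a <= pi ->
  f a * sin (b - x) + f b * sin (x - a) <= f x * sin (b - a).
Hypothesis f_half : forall a x, 0 <= f a -> 0 <= f (a + pi) ->
  a < x < a + pi -> 0 < f x.
Implicit Types a b x y z : R.

(** The three-point inequality can be divided by [sin (b - a)] unless [b - a] is [pi], where the
    sine vanishes and [f_half] takes over. *)
Lemma sine_concave_ge0 a b x : 0 <= f a -> 0 <= f b -> b - a <= pi ->
  a <= x <= b -> 0 <= f x.
Proof.
move=> a0 b0 ab /andP[]; rewrite le_eqVlt => /predU1P[<-//|ax].
rewrite le_eqVlt => /predU1P[->//|xb].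
have [e|ne] := eqVneq (b - a) pi.
  have bE : b = a + pi by rewrite -e addrC subrK.
  by apply/ltW/(f_half a); rewrite -?bE ?ax.
have s0 : 0 < sin (b - a).
  by apply: sin_gt0_pi; rewrite subr_gt0 (lt_trans ax xb) lt_neqAle ne.
rewrite -(pmulr_lge0 _ s0).
apply: le_trans (f_three_point a b x (ltW ax) (ltW xb) ab).
by rewrite addr_ge0// mulr_ge0// sin_ge0_pi//; apply/andP; split; lra.
Qed.

Lemma sine_concave_gt0 a b x : 0 <= f a -> 0 <= f b -> b - a < pi ->
  0 < f a + f b -> a < x < b -> 0 < f x.
Proof.
move=> a0 b0 ab ab0 /andP[ax xb].
have s0 : 0 < sin (b - a) by apply: sin_gt0_pi; apply/andP; split; lra.
have s1 : 0 < sin (b - x) by apply: sin_gt0_pi; apply/andP; split; lra.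
have s2 : 0 < sin (x - a) by apply: sin_gt0_pi; apply/andP; split; lra.
rewrite -(pmulr_lgt0 _ s0).
apply: lt_le_trans (f_three_point a b x (ltW ax) (ltW xb) (ltW ab)).
have [fa|fa] := ltP 0 (f a).
  by rewrite ltr_pwDl ?mulr_gt0// mulr_ge0// ltW.
by rewrite ltr_wpDl ?mulr_ge0 ?mulr_gt0// ?(ltW s1)//; lra.
Qed.

(** Below length [pi], [sine_concave_gt0] applies between [x0] and the endpoint on the side of [x];
    at length [pi], [f_half] applies. *)
Lemma sine_concave_arc_gt0 a b x0 x : 0 <= f a -> 0 <= f b -> b - a <= pi ->
  a <= x0 <= b -> 0 < f x0 -> a < x < b -> 0 < f x.
Proof.
move=> a0 b0 ab /andP[ax0 x0b] fx0 /andP[ax xb].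
have [e|ne] := eqVneq (b - a) pi.
  have bE : b = a + pi by rewrite -e addrC subrK.
  by apply: (f_half a); rewrite -?bE ?ax.
have {}ab : b - a < pi by rewrite lt_neqAle ne.
have [xx0|x0x|->//] := ltgtP x x0.
  by apply: (sine_concave_gt0 a x0); rewrite ?(ltW fx0) ?ax//; lra.
by apply: (sine_concave_gt0 x0 b); rewrite ?(ltW fx0) ?xb ?x0x//; lra.
Qed.

(** The three-point weights are the sines of [s * (y - x)] and [(1 - s) * (y - x)]; by [sin_mul_lt]
    they exceed [s] and [1 - s] times [sin (y - x)]. Positivity of [f] at both ends carries this
    over to the sum. *)
Lemma sine_concave_strict x y s : 0 < f x -> 0 < f y -> 0 < y - x < pi ->
  0 < s < 1 -> s * f x + (1 - s) * f y < f (s * x + (1 - s) * y).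
Proof.
move=> x0 y0 /[dup] xy /andP[xy0 xypi] /[dup] s01 /andP[s0 s1].
have sD : 0 < sin (y - x) by exact: sin_gt0_pi.
rewrite -(ltr_pM2r sD).
have h1 : x <= s * x + (1 - s) * y.
  rewrite -subr_ge0 (_ : _ - x = (1 - s) * (y - x)); last by ring.
  by rewrite mulr_ge0//; lra.
have h2 : s * x + (1 - s) * y <= y.
  rewrite -subr_ge0 (_ : y - _ = s * (y - x)); last by ring.
  by rewrite mulr_ge0//; lra.
apply: lt_le_trans (f_three_point x y _ h1 h2 (ltW xypi)).
have -> : y - (s * x + (1 - s) * y) = s * (y - x) by ring.
have -> : s * x + (1 - s) * y - x = (1 - s) * (y - x) by ring.
have s01' : 0 < 1 - s < 1 by apply/andP; split; lra.
have := sin_mul_lt _ _ xy s01; rewrite -(ltr_pM2l x0) => k1.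
have := sin_mul_lt _ _ xy s01'; rewrite -(ltr_pM2l y0) => k2.
rewrite mulrDl; apply: le_lt_trans (ltrD k1 k2).
by rewrite !mulrA [f x * s]mulrC [f y * _]mulrC.
Qed.

Hypothesis f_continuous : continuous f.

(** By continuity, the part of the superlevel set within [pi] of [x0] is compact; [a] and [b] are
    its minimum and maximum. *)
Lemma sine_concave_extremal x0 : 0 <= f x0 -> exists a b,
  [/\ x0 - pi <= a <= x0, x0 <= b <= x0 + pi, 0 <= f a, 0 <= f b &
    forall x, x0 - pi <= x <= x0 + pi -> 0 <= f x -> a <= x <= b].
Proof.
move=> fx0; pose S := `[x0 - pi, x0 + pi] `&` [set x | 0 <= f x].
have cS : compact S.
  apply: (@subclosed_compact _ _ `[x0 - pi, x0 + pi]); last by move=> x [].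
    apply: closedI; first exact: interval_closed.
    exact: (preimage_closed (fun x _ => f_continuous x) (@closed_ge R 0)).
  exact: segment_compact.
have Sx0 : S x0.
  split => //=; rewrite in_itv/=.
  by have := @pi_ge0 R => ?; apply/andP; split; lra.
have cid : {within S, continuous (@id R)}.
  by apply: continuous_subspaceT => x; exact: cvg_id.
have [a + amin] := compact_EVT_min (ex_intro _ x0 Sx0) cS cid.
have [b + bmax] := compact_EVT_max (ex_intro _ x0 Sx0) cS cid.
rewrite !inE => -[+ fb] [+ fa]; rewrite /= !in_itv/= => /andP[_ b2] /andP[a1 _].
exists a, b; split => //.
- by rewrite a1 /=; apply: amin; rewrite inE.
- by rewrite b2 andbT; apply: bmax; rewrite inE.
- by move=> x xI fx; rewrite amin ?bmax// inE; split => //=; rewrite in_itv.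
Qed.

End sine_concave.

(** * The shape of the superlevel set on the circle *)

Section circle_superlevel.
Context {R : realType} (alpha : R).
Hypothesis halpha : 2 * pi < alpha.
Context (M : circle alpha -> R).
Implicit Types (t : circle alpha) (x y a b : R).
Local Notation c := (to_circle alpha).
Local Notation f := (fun x => M (c x)).
Hypothesis M_three_point : forall a b x, a <= x -> x <= b -> b - a <= pi ->
  M (c a) * sin (b - x) + M (c b) * sin (x - a) <= M (c x) * sin (b - a).
Hypothesis M_half : forall a x, 0 <= M (c a) -> 0 <= M (c (a + pi)) ->
  a < x < a + pi -> 0 < M (c x).
Hypothesis M_antipodal :
  forall t1 t2, pi <= angle_dist t1 t2 -> M t1 + M t2 <= 0.
Hypothesis M_antipodal_lt :
  forall t1 t2, pi < angle_dist t1 t2 -> M t1 + M t2 < 0.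
Hypothesis M_continuous : continuous f.
Local Notation K := [set t | 0 <= M t].

Let alpha_gt0 : 0 < alpha.
Proof. by move: halpha (@pi_gt0 R); lra. Qed.

Lemma superlevel_arc x0 : 0 <= M (c x0) -> exists a b : R,
  [/\ a <= x0 <= b, b - a <= pi, 0 <= M (c a), 0 <= M (c b) &
      K = circle_arc alpha a b].
Proof.
move=> K0.
have [a [b [/andP[a1 a2] /andP[b1 b2] fa fb max]]] :=
  sine_concave_extremal _ M_continuous _ K0.
have arc x : a <= x <= b -> 0 <= f x.
  have ax0 : x0 - a <= pi by lra.
  have bx0 : b - x0 <= pi by lra.
  move=> /andP[ax xb]; have [xx0|/ltW x0x] := leP x x0.
    apply: (sine_concave_ge0 f M_three_point M_half a x0 x) => //.
    by rewrite ax.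
  by apply: (sine_concave_ge0 f M_three_point M_half x0 b x) => //; rewrite x0x.
have ab : b - a <= pi.
  rewrite leNgt; apply/negP => ab.
  (* If the arc were longer than [pi], [a + y] would be on it at circle distance [y > pi] from [a],
     against [M_antipodal_lt]. The cap [alpha / 2] makes [y] the true circle distance. *)
  pose y := Num.min (b - a) (alpha / 2).
  have ypi : pi < y by rewrite lt_min ab; move: halpha; lra.
  have yab : a <= a + y <= b.
    have yb : y <= b - a by rewrite ge_min lexx.
    by have := @pi_gt0 R => ?; apply/andP; split; lra.
  have d : angle_dist (c a) (c (a + y)) = y.
    rewrite (angle_dist_small _ alpha_gt0 _ _ y).
    - by rewrite ger0_norm//; have := @pi_gt0 R; lra.
    - by rewrite -to_circleB addrC addKr.
    - by rewrite ger0_norm; [rewrite ge_min lexx orbT|have := @pi_gt0 R; lra].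
  rewrite -d in ypi; have := M_antipodal_lt _ _ ypi.
  by rewrite ltNge => /negP; apply; apply: addr_ge0 => //; exact: arc.
exists a, b; split => //; first by rewrite a2.
apply/seteqP; split => [t Kt|_ [x xab <-]]; last first.
  by apply: arc; rewrite /= in_itv in xab.
have [x xt xd] := angle_dist_lift_from _ alpha_gt0 x0 t.
(* Every point of [K] thus has a lift in the window where [a] and [b] are extremal. *)
have dpi : angle_dist (c x0) t <= pi.
  rewrite leNgt; apply/negP => /(M_antipodal_lt).
  by rewrite ltNge addr_ge0.
exists x => //=; rewrite in_itv/=; apply: max.
  by move: dpi; rewrite -xd ler_norml => /andP[? ?]; apply/andP; split; lra.
by rewrite xt.
Qed.

Lemma interior_superlevel x0 : 0 < M (c x0) -> (K)° (c x0).
Proof.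
move=> fx0; rewrite /interior nbhsE; exists [set t | 0 < M t]; last first.
  by move=> t /ltW.
(* Open sets of the quotient topology are those with open preimage under [c]. *)
split => //; change (open (f @^-1` [set y | 0 < y])).
by apply: open_comp => [x _|]; [exact: M_continuous|exact: open_gt].
Qed.

(** An interior point [t] can be overshot slightly, away from [x0], without leaving [K]. Then [t]
    lies strictly between [x0], where [M] is positive, and a point where it is nonnegative. *)
Lemma interior_superlevel_gt0 x0 t : 0 < M (c x0) -> (K)° t ->
  0 < M t.
Proof.
move=> fx0 it; rewrite ltNge; apply/negP => t0.
have [y yt yd] := angle_dist_lift_from _ alpha_gt0 x0 t.
have dpi : angle_dist (c x0) t < pi.
  rewrite ltNge; apply/negP => /(M_antipodal).
  have := interior_subset it; rewrite /= => tge.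
  by rewrite leNgt ltr_pwDl.
rewrite -yt in it t0 dpi yd.
have : nbhs y (c @^-1` K).
  exact: to_circle_continuous it.
move=> /nbhs_ballP[e /= e0 ye].
have yx : y != x0 by apply/eqP => yx; move: fx0; rewrite -yx ltNge t0.
(* The overshoot stays in the ball of radius [e] inside the preimage of [K], and at distance less
   than [pi] from [x0]. *)
pose s := Num.min (e / 2) ((pi - `|y - x0|) / 2).
have s0 : 0 < s by rewrite lt_min !divr_gt0// subr_gt0 yd.
have se : s < e.
  by apply: le_lt_trans (_ : e / 2 < e); [rewrite ge_min lexx|lra].
have spi : s < pi - `|y - x0|.
  apply: le_lt_trans (_ : (pi - `|y - x0|) / 2 < _).
    by rewrite ge_min lexx orbT.
  by rewrite gtr_pMr ?subr_gt0 ?yd//; lra.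
move: t0; rewrite leNgt => /negP; apply.
have [xy|yx0|e'] := ltgtP x0 y; last by rewrite e' eqxx in yx.
  rewrite gtr0_norm ?subr_gt0// in spi.
  have fz : 0 <= f (y + s).
    by apply: ye; rewrite /ball/= opprD addNKr normrN gtr0_norm.
  apply: (sine_concave_gt0 f M_three_point x0 (y + s) y) => //.
  - exact: ltW.
  - by rewrite addrAC; move: spi; rewrite ltrBrDl addrC.
  - by rewrite ltr_pwDl.
  - by rewrite xy ltrDl.
rewrite ltr0_norm ?subr_lt0// in spi.
have fz : 0 <= f (y - s).
  by apply: ye; rewrite /ball/= opprD opprK addNKr gtr0_norm.
apply: (sine_concave_gt0 f M_three_point (y - s) x0 y) => //.
- exact: ltW.
- by move: spi; lra.
- by rewrite ltr_wpDl.
- by rewrite yx0 gtrDl oppr_lt0 s0.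
Qed.


Lemma superlevel_trichotomy : [\/ K = set0,
  K !=set0 /\ (forall t, K t -> M t = 0) |
  K° !=set0 /\ (forall t, K° t -> 0 < M t)].
Proof.
have [K0|/set0P[t Kt]] := eqVneq K set0; first by constructor 1.
have [K1|/existsNP[s /not_implyP[Ks /eqP Ms]]] :=
  pselect (forall t, K t -> M t = 0).
  by constructor 2; split => //; exists t.
constructor 3; have [x0 xs] := to_circle_surj alpha s; rewrite -xs in Ks Ms.
have Mx0 : 0 < M (c x0) by rewrite lt_neqAle eq_sym Ms.
split; last by move=> u; exact: (interior_superlevel_gt0 x0).
by exists (c x0); exact: interior_superlevel.
Qed.

Lemma superlevel_arc_of_eq0 : K !=set0 -> (forall t, K t -> M t = 0) ->
  exists a b, [/\ a <= b, b - a < pi & K = circle_arc alpha a b].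
Proof.
move=> [t Kt] K0; have [x0 xt] := to_circle_surj alpha t; rewrite -{}xt in Kt.
have [a [b [/andP[ax0 x0b] ab Ma Mb KE]]] := superlevel_arc _ Kt.
exists a, b; split => //; first exact: le_trans x0b.
rewrite lt_neqAle ab andbT; apply/eqP => e.
(* On an arc of length [pi], [M] would be positive at the midpoint. *)
have Mm : 0 < M (c (a + pi / 2)).
  apply: (M_half a) => //; first by rewrite -e addrC subrK.
  by have := @pi_gt0 R => ?; apply/andP; split; lra.
by have := K0 _ (ltW Mm); move: Mm => /[swap] ->; rewrite ltxx.
Qed.

Lemma superlevel_arc_concave t : 0 < M t ->
  exists a b, [/\ a <= b, b - a <= pi, K = circle_arc alpha a b &
    strictly_concave_on `]a, b[ (fun x => M (c x))].
Proof.
have [x0 <-] := to_circle_surj alpha t => Mx0.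
have [a [b [x0ab ab Ma Mb KE]]] := superlevel_arc _ (ltW Mx0).
exists a, b; split => //; first by case/andP: x0ab; exact: le_trans.
(* One positive value spreads to the whole open arc, as [sine_concave_strict] requires. *)
have Mpos x : `]a, b[%classic x -> 0 < M (c x).
  rewrite /= in_itv/= => xab.
  exact: (sine_concave_arc_gt0 f M_three_point M_half a b x0).
have concave x y s : `]a, b[%classic x -> `]a, b[%classic y -> x < y ->
    0 < s < 1 ->
    s * M (c x) + (1 - s) * M (c y) < M (c (s * x + (1 - s) * y)).
  move=> xab yab xy.
  apply: (sine_concave_strict f M_three_point); [exact: Mpos..|].
  move: xab yab; rewrite /= !in_itv/= => /andP[? ?] /andP[? ?].
  by apply/andP; split; lra.
move=> x y xab yab xy s s01.
have [lt_xy|lt_yx|e] := ltgtP x y; [exact: concave| |by rewrite e eqxx in xy].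
have s01' : 0 < 1 - s < 1 by move: s01 => /andP[? ?]; apply/andP; split; lra.
have := concave _ _ _ yab xab lt_yx s01'.
by rewrite subKr [X in X < _]addrC [(1 - s) * y + _]addrC.
Qed.

End circle_superlevel.

Theorem proposition1p10 (R : realType) (alpha : R) (halpha : 2 * pi < alpha)
    (mu : probability (kale alpha) R)
    (hint : kale_integrable mu) (hnd : kale_nondegenerate mu) :
  [/\ [\/ fully_sticky mu, partly_sticky mu | nonsticky mu],
      partly_sticky mu ->
        exists a b : R, [/\ a <= b, b - a < pi &
          nonneg_angles mu = circle_arc alpha a b]
    & nonsticky mu ->
        exists a b : R, [/\ a <= b, b - a <= pi,
          nonneg_angles mu = circle_arc alpha a b &
          strictly_concave_on `]a, b[
            (fun x => (folded_moment mu (to_circle alpha x)).1)]].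
Proof.
have M3 := moment_three_point _ halpha _ hint.
have Mh := moment_half_circle _ halpha _ hint hnd.
have Ma := moment_antipodal _ halpha _ hint.
have Mlt := moment_antipodal_lt _ halpha _ hint hnd.
have Mc := moment_continuous _ halpha _ hint.
split.
- exact: superlevel_trichotomy _ halpha _ M3 Ma Mc.
- by move=> [K0 M0]; exact: (superlevel_arc_of_eq0 _ halpha _ M3 Mh Mlt Mc).
- move=> [[t it] Mpos].
  exact: (superlevel_arc_concave _ halpha _ M3 Mh Mlt Mc _ (Mpos t it)).
Qed.
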